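(* Let $\mathbf{x}_1,\dots,\mathbf{x}_N\in\mathbb{R}^K$ be nonzero, let $\mathbf{T}$ be a real symmetric positive definite $K\times K$ matrix, and let $\alpha_0>0$. If the equation $$\boldsymbol{\Sigma}=\frac{1}{1+\alpha_0}\frac KN\sum_{i=1}^N\frac{\mathbf{x}_i\mathbf{x}_i^T}{\mathbf{x}_i^T\boldsymbol{\Sigma}^{-1}\mathbf{x}_i}+\frac{\alpha_0}{1+\alpha_0}\frac{K\mathbf{T}}{\mathrm{Tr}(\boldsymbol{\Sigma}^{-1}\mathbf{T})}$$ has a solution $\boldsymbol{\Sigma}$ among the real symmetric positive definite $K\times K$ matrices, then this solution is unique up to a positive scaling factor: any two positive definite solutions are positive scalar multiples of each other. *)

(* Defs.v *)
From HB Require Import structures.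
From mathcomp Require Import all_boot all_order all_algebra.
From mathcomp Require Import reals.

Set Implicit Arguments.
Unset Strict Implicit.
Unset Printing Implicit Defensive.

Import Order.TTheory GRing.Theory Num.Theory.
Local Open Scope ring_scope.

Definition quad_form (R : realType) (K : nat) (A : 'M[R]_K) (v : 'cV[R]_K) : R :=
  (v^T *m A *m v) 0 0.

Definition spd (R : realType) (K : nat) (A : 'M[R]_K) : Prop :=
  A \is symmetricmx /\ forall v : 'cV[R]_K, v != 0 -> 0 < quad_form A v.

(* The denominators below are positive when [S] and [T] are [spd], the [x i]
   are nonzero and [0 < K, N], so the conventions for [invmx] on singular
   matrices and for division by zero do not come into play. *)
Definition fixed_point_eq (R : realType) (K N : nat) (x : 'I_N -> 'cV[R]_K)
    (T : 'M[R]_K) (alpha0 : R) (S : 'M[R]_K) : Prop :=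
  S = (1 / (1 + alpha0) * (K%:R / N%:R)) *:
        (\sum_(i < N) (quad_form (invmx S) (x i))^-1 *: (x i *m (x i)^T))
    + (alpha0 / (1 + alpha0)) *: ((\tr (invmx S *m T))^-1 *: (K%:R *: T)).

(* Main.v *)
(** Let [l] be the least scalar with [S1 <= l S2] in the Loewner order.  Both
    [A = S1] and [B = l S2] solve the equation.  Inversion is antitone, so
    each [x_i]-term of [B - A] is positive semidefinite, and [B - A] dominates
    a positive multiple of [(1 / Tr (B^-1 T) - 1 / Tr (A^-1 T)) T], whose
    coefficient is nonnegative.
    If the coefficient is positive then [B - A >= d T >= d' S2] with [d' > 0],
    which contradicts the minimality of [l].  If it is zero then
    [Tr ((A^-1 - B^-1) T) = 0] with [A^-1 - B^-1 >= 0] and [T > 0], which forces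
    [A = B].  Only the infimum defining [l] is used, so no eigenvector has to
    be produced by compactness. *)
Require Import Defs.
From HB Require Import structures.
From mathcomp Require Import all_boot all_order all_algebra.
From mathcomp Require Import reals.
From mathcomp Require Import ring lra.

Set Implicit Arguments.
Unset Strict Implicit.
Unset Printing Implicit Defensive.

Import Order.TTheory GRing.Theory Num.Theory.
Local Open Scope ring_scope.

Section Forms.
Context {R : realType} {K : nat}.
Implicit Types (A B S T : 'M[R]_K) (u v w : 'cV[R]_K) (c : R).

(** * Bilinear forms *)

Definition bilin A u v : R := (u^T *m A *m v) 0 0.

Lemma quad_formE A v : quad_form A v = bilin A v v. Proof. by []. Qed.

Lemma bilinDl A u v w : bilin A (u + v) w = bilin A u w + bilin A v w.
Proof. by rewrite /bilin linearD /= !mulmxDl mxE. Qed.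

Lemma bilinDr A u v w : bilin A u (v + w) = bilin A u v + bilin A u w.
Proof. by rewrite /bilin mulmxDr mxE. Qed.

Lemma bilinZl A c u v : bilin A (c *: u) v = c * bilin A u v.
Proof. by rewrite /bilin linearZ /= -!scalemxAl mxE. Qed.

Lemma bilinZr A c u v : bilin A u (c *: v) = c * bilin A u v.
Proof. by rewrite /bilin -scalemxAr mxE. Qed.

Lemma bilinDm A B u v : bilin (A + B) u v = bilin A u v + bilin B u v.
Proof. by rewrite /bilin mulmxDr mulmxDl mxE. Qed.

Lemma bilinNm A u v : bilin (- A) u v = - bilin A u v.
Proof. by rewrite /bilin mulmxN mulNmx mxE. Qed.

Lemma bilinZm c A u v : bilin (c *: A) u v = c * bilin A u v.
Proof. by rewrite /bilin -scalemxAr -scalemxAl mxE. Qed.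

Lemma bilin_sym A u v : A^T = A -> bilin A u v = bilin A v u.
Proof.
by move=> sA; rewrite /bilin -trace_mx11 -mxtrace_tr trace_mx11
  !trmx_mul trmxK sA mulmxA.
Qed.

Lemma bilin_mulr A B u v : bilin A u (B *m v) = bilin (A *m B) u v.
Proof. by rewrite /bilin !mulmxA. Qed.

Lemma bilin_mull A B u v : bilin A (B *m u) v = bilin (B^T *m A) u v.
Proof. by rewrite /bilin trmx_mul !mulmxA. Qed.

Lemma bilin_rank1 w u v :
  bilin (w *m w^T) u v = bilin 1%:M u w * bilin 1%:M w v.
Proof.
by rewrite /bilin !mulmx1 !mulmxA -mulmxA mxE big_ord1.
Qed.

Lemma tr_rank1 w T : \tr (w *m w^T *m T) = bilin T w w.
Proof. by rewrite -mulmxA mxtrace_mulC trace_mx11. Qed.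

(** * Semidefinite matrices and rank-one decompositions *)

Definition psd A := A^T = A /\ forall v, 0 <= bilin A v v.

Lemma spdP A : spd A <-> A^T = A /\ forall v, v != 0 -> 0 < bilin A v v.
Proof.
rewrite /spd; have -> : (A \is symmetricmx) = (A^T == A).
  by rewrite is_hermitianmxE expr0 scale1r map_mx_id // eq_sym.
by split=> -[/eqP sA posA].
Qed.

Lemma spd_psd A : spd A -> psd A.
Proof.
move=> /spdP[sA pA]; split=> // v; have [->|/pA/ltW//] := eqVneq v 0.
by rewrite /bilin mulmx0 mxE.
Qed.

Lemma spdZ c A : 0 < c -> spd A -> spd (c *: A).
Proof.
move=> c0 /spdP[sA pA]; apply/spdP; split; first by rewrite linearZ /= sA.
by move=> v /pA; rewrite bilinZm; apply: mulr_gt0.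
Qed.

Lemma psd_isotropic A v : psd A -> bilin A v v = 0 -> A *m v = 0.
Proof.
move=> [sA pA] v0.
have A0 u : bilin A u v = 0.
  apply/eqP/negPn/negP => uv0.
  (* The multiple of [v] is chosen so that the form would take the value -1 here. *)
  have := pA (u + (- (bilin A u u + 1) / (2 * bilin A u v)) *: v).
  rewrite bilinDl !bilinDr !bilinZl !bilinZr v0 (bilin_sym v u sA).
  suff -> : - (bilin A u u + 1) / (2 * bilin A u v) * bilin A u v =
    - (bilin A u u + 1) / 2 by lra.
  by field; rewrite uv0.
apply/colP => i; have := A0 (delta_mx i 0).
by rewrite /bilin -mulmxA trmx_delta -rowE !mxE.
Qed.

(** In Cauchy-Schwarz style: the form of [A] at [u + t v] is quadratic in [t], and its minimum, at
    [t = - b / a], is the deflated form at [u]. *)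
Lemma psd_deflate A v : psd A -> 0 < bilin A v v ->
  psd (A - (bilin A v v)^-1 *: ((A *m v) *m (A *m v)^T)).
Proof.
move=> [sA pA] a0; split.
  by rewrite linearB linearZ /= trmx_mul trmxK sA.
move=> u; rewrite bilinDm bilinNm bilinZm bilin_rank1.
rewrite bilin_mulr bilin_mull sA mul1mx mulmx1 (bilin_sym v u sA).
set a := bilin A v v in a0 *; set b := bilin A u v.
have := pA (u + (- b / a) *: v).
rewrite bilinDl !bilinDr !bilinZl !bilinZr (bilin_sym v u sA) -/a -/b.
suff -> : bilin A u u + - b / a * b + (- b / a * b + - b / a * (- b / a * a)) =
  bilin A u u - a^-1 * (b * b) by [].
by field; rewrite gt_eqF.
Qed.

(* Eliminates the coordinate vectors one by one, as in an LDL decomposition. *)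
Lemma psd_rank1_ind (P : 'M[R]_K -> Prop) :
  P 0 ->
  (forall A c w, 0 <= c -> P A -> P (A + c *: (w *m w^T))) ->
  forall A, psd A -> P A.
Proof.
move=> P0 PD A.
(* Induct on a bound [n] beyond which all columns of [A] vanish; [n = K] holds vacuously, and
   [n = 0] means [A = 0]. *)
have [n] : exists n, forall i : 'I_K, (n <= i)%N ->
    A *m delta_mx i (0 : 'I_1) = 0.
  by exists K => i; rewrite leqNgt ltn_ord.
elim: n A => [|n IH] A An psdA.
  suff -> : A = 0 by [].
  apply/matrixP => i j; have /colP/(_ i) := An j isT.
  by rewrite -colE !mxE.
have [nK|nK] := ltnP n K; last first.
  by apply: IH => // i ni; have := leq_trans nK ni; rewrite leqNgt ltn_ord.
pose e : 'cV[R]_K := delta_mx (Ordinal nK) 0.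
have eq_e (i : 'I_K) : (n <= i)%N -> i = Ordinal nK \/ (n.+1 <= i)%N.
  rewrite leq_eqVlt => /orP[/eqP ni|]; last by right.
  by left; apply/val_inj.
(* A zero diagonal entry forces column [n] to vanish already; otherwise deflating at [e] kills it
   and keeps the later columns zero. *)
have [a0|a_neq0] := eqVneq (bilin A e e) 0.
  apply: IH => // i /eq_e[->|/An//]; exact: psd_isotropic.
have a_gt0 : 0 < bilin A e e by rewrite lt_def a_neq0 psdA.2.
have psdA' := psd_deflate psdA a_gt0.
have ai_gt0 : 0 <= (bilin A e e)^-1 by rewrite invr_ge0 ltW.
rewrite -[A](subrK ((bilin A e e)^-1 *: ((A *m e) *m (A *m e)^T))).
apply: (PD _ _ _ ai_gt0); apply: IH => // i /eq_e[->|ni]; last first.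
  rewrite mulmxBl An // -scalemxAl trmx_mul psdA.1 -!mulmxA An //.
  by rewrite !mulmx0 scaler0 subr0.
rewrite -/e mulmxBl -scalemxAl -[X in _ *: X]mulmxA trmx_mul psdA.1.
rewrite [e^T *m A *m e]mx11_scalar mul_mx_scalar scalerA mulVf //.
by rewrite scale1r subrr.
Qed.

(** Each rank-one summand contributes [c * bilin T w w], which is nonnegative and vanishes only if
    [c = 0] or [w = 0]. *)
Lemma psd_tr_spd A T : psd A -> spd T ->
  0 <= \tr (A *m T) /\ (\tr (A *m T) = 0 -> A = 0).
Proof.
move=> psdA spdT; have psdT := spd_psd spdT; have /spdP[_ pT] := spdT.
elim/psd_rank1_ind: A / psdA => [|A c w c0 [trA trA0]].
  by rewrite mul0mx mxtrace0.
rewrite mulmxDl mxtraceD -scalemxAl mxtraceZ tr_rank1.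
have cw : 0 <= c * bilin T w w by rewrite mulr_ge0 // psdT.2.
split=> [|/eqP]; first exact: addr_ge0.
rewrite paddr_eq0 // => /andP[/eqP/trA0 ->]; rewrite mulf_eq0 add0r.
move=> /orP[/eqP->|]; first by rewrite scale0r.
have [->|/pT/gt_eqF->//] := eqVneq w 0.
by rewrite mul0mx scaler0.
Qed.

(** * Inverses and the Loewner order *)

Lemma spd_unitmx A : spd A -> A \in unitmx.
Proof.
move=> /spdP[sA pA]; rewrite -row_free_unit; apply: inj_row_free => v vA.
apply/eqP/negPn/negP => v0; have := pA v^T.
by rewrite trmx_eq0 => /(_ v0); rewrite /bilin trmxK vA mul0mx mxE ltxx.
Qed.

Lemma spd_invmx A : spd A -> spd (invmx A).
Proof.
move=> spdA; have uA := spd_unitmx spdA; have /spdP[sA pA] := spdA.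
apply/spdP; split=> [|v v0]; first by rewrite trmx_inv sA.
have -> : v = A *m (invmx A *m v) by rewrite mulKVmx.
rewrite bilin_mull bilin_mulr sA mulmxKV //.
apply: pA; apply: contraNneq v0 => v0.
by rewrite -(mulKVmx uA v) v0 mulmx0.
Qed.

(* [u^T A^-1 u] is the maximum over [w] of [2 u^T w - w^T A w]; take
   [w = B^-1 u]. *)
Lemma psd_invmxB A B : spd A -> spd B -> psd (B - A) ->
  psd (invmx A - invmx B).
Proof.
move=> spdA spdB [_ leAB].
have [sA pA] := spd_psd spdA; have [siA _] := spd_psd (spd_invmx spdA).
have [sB _] := spd_psd spdB; have [siB _] := spd_psd (spd_invmx spdB).
split=> [|u]; first by rewrite linearB /= siA siB.
have invl S z : S^T = S -> spd S -> bilin S (invmx S *m u) z = bilin 1%:M u z.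
  by move=> sS /spd_unitmx uS; rewrite bilin_mull trmx_inv sS mulVmx.
have invr S : bilin 1%:M u (invmx S *m u) = bilin (invmx S) u u.
  by rewrite bilin_mulr mul1mx.
(* This inequality and the next add up to the claim: the terms in [bilin A] at [invmx B *m u]
   cancel. *)
have := leAB (invmx B *m u).
have := pA (invmx A *m u + (-1) *: (invmx B *m u)).
rewrite !(bilinDm, bilinNm) bilinDl !bilinDr !bilinZl !bilinZr.
rewrite (bilin_sym (invmx B *m u) (invmx A *m u) sA) !invl // !invr; lra.
Qed.

(** Deflating [invmx T] at [T *m v] subtracts [v *m v^T] divided by [bilin T v v]; the trace of the
    result against [S] is nonnegative, which is the bound at [v]. *)
Lemma psd_trB S T : spd S -> spd T -> psd (\tr (invmx T *m S) *: T - S).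
Proof.
move=> spdS spdT; have /spdP[sT pT] := spdT; have /spdP[sS _] := spdS.
have uT := spd_unitmx spdT.
split=> [|v]; first by rewrite linearB linearZ /= sT sS.
rewrite bilinDm bilinNm bilinZm.
have [->|/pT v0] := eqVneq v 0.
  by rewrite /bilin !mulmx0 !mxE mulr0 subr0.
have iTv : bilin (invmx T) (T *m v) (T *m v) = bilin T v v.
  by rewrite bilin_mulr bilin_mull sT mulVmx // mulmx1.
have := @psd_deflate (invmx T) (T *m v) (spd_psd (spd_invmx spdT)).
rewrite iTv mulKmx // => /(_ v0) /psd_tr_spd /(_ spdS)[+ _].
rewrite mulmxBl linearB /= -scalemxAl mxtraceZ tr_rank1 !subr_ge0.
by rewrite mulrC ler_pdivrMr.
Qed.

(** * The least multiple in the Loewner order *)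

Lemma cV_neq0 : (0 < K)%N -> exists e : 'cV[R]_K, e != 0.
Proof.
move=> K0; exists (const_mx 1); apply/eqP => /colP/(_ (Ordinal K0))/eqP.
by rewrite !mxE oner_eq0.
Qed.

Lemma spd_neq0 A : (0 < K)%N -> spd A -> A != 0.
Proof.
move=> /cV_neq0[e e0] /spdP[_ /(_ e e0)]; apply: contraTneq => ->.
by rewrite /bilin mulmx0 mul0mx mxE ltxx.
Qed.

Lemma spd_least_multiple S1 S2 : (0 < K)%N -> spd S1 -> spd S2 ->
  exists l, [/\ 0 < l, psd (l *: S2 - S1) &
    forall d, 0 < d -> ~ psd (l *: S2 - S1 - d *: S2)].
Proof.
move=> K0 spd1 spd2; have /spdP[s1 p1] := spd1; have /spdP[s2 p2] := spd2.
(* The generalized Rayleigh quotients of the pair; [psd_trB] bounds them, and their supremum is the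
   required [l]. *)
pose E : classical_sets.set R := fun r =>
  exists2 v, v != 0 & r = bilin S1 v v / bilin S2 v v.
have [e e0] := cV_neq0 K0.
have Ee : E (bilin S1 e e / bilin S2 e e) by exists e.
have Eub : classical_sets.has_ubound E.
  exists (\tr (invmx S2 *m S1)) => _ [v v0 ->].
  have [_ /(_ v)] := psd_trB spd1 spd2.
  by rewrite bilinDm bilinNm bilinZm subr_ge0 ler_pdivrMr ?p2.
exists (sup E); split.
- by apply: lt_le_trans (ub_le_sup Eub Ee); rewrite divr_gt0 ?p1 ?p2.
- split=> [|v]; first by rewrite linearB linearZ /= s1 s2.
  have [->|v0] := eqVneq v 0; first by rewrite /bilin mulmx0 mxE.
  rewrite bilinDm bilinNm bilinZm subr_ge0 -ler_pdivrMr ?p2 //.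
  by apply: ub_le_sup => //; exists v.
- move=> d d0 [_ psd_d].
  (* If [d *: S2] could still be subtracted, [sup E - d] would bound all quotients. *)
  suff : sup E <= sup E - d by rewrite lerBrDr gerDl leNgt d0.
  apply: ge_sup => [|_ [v v0 ->]]; first by eexists; exact: Ee.
  rewrite ler_pdivrMr ?p2 // -subr_ge0.
  by have := psd_d v; rewrite !(bilinDm, bilinNm, bilinZm); lra.
Qed.

(** * The semidefinite cone and positivity of traces *)

Lemma psdD A B : psd A -> psd B -> psd (A + B).
Proof.
move=> [sA pA] [sB pB]; split=> [|v]; first by rewrite linearD /= sA sB.
by rewrite bilinDm addr_ge0.
Qed.

Lemma psdZ c A : 0 <= c -> psd A -> psd (c *: A).
Proof.
move=> c0 [sA pA]; split=> [|v]; first by rewrite linearZ /= sA.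
by rewrite bilinZm mulr_ge0.
Qed.

Lemma psd0 : psd (0 : 'M[R]_K).
Proof. by split=> [|v]; rewrite ?trmx0 // /bilin mulmx0 mul0mx mxE. Qed.

Lemma psd_rank1 w : psd (w *m w^T).
Proof.
split=> [|v]; first by rewrite trmx_mul trmxK.
by rewrite bilin_rank1 (bilin_sym v) ?trmx1 // -expr2 sqr_ge0.
Qed.

Lemma spd_invmx_tr_gt0 S T : (0 < K)%N -> spd S -> spd T ->
  0 < \tr (invmx S *m T).
Proof.
move=> K0 spdS spdT; have spdi := spd_invmx spdS.
have [tr_ge0 tr_eq0] := psd_tr_spd (spd_psd spdi) spdT.
rewrite lt_def tr_ge0 andbT; apply/eqP => /tr_eq0 iS0.
by have := spd_neq0 K0 spdi; rewrite iS0 eqxx.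
Qed.

(** * The fixed-point equation *)

Section FixedPoint.
Context {N : nat} (x : 'I_N -> 'cV[R]_K) (T : 'M[R]_K) (alpha0 : R).

(** The right-hand side is homogeneous of degree one in [S], because [invmx] has degree -1 and
    enters only through reciprocals. *)
Lemma fixed_point_eqZ c S : 0 < c -> spd S ->
  fixed_point_eq x T alpha0 S -> fixed_point_eq x T alpha0 (c *: S).
Proof.
move=> c0 spdS; rewrite /fixed_point_eq.
have uS := spd_unitmx spdS.
have uc : c \is a GRing.unit by rewrite unitfE gt_eqF.
rewrite invmxZ ?unitmxZ // => {1}->; rewrite scalerDr; congr (_ + _).
  rewrite !scaler_sumr; apply: eq_bigr => i _.
  by rewrite !quad_formE bilinZm invfM invrK !scalerA; congr (_ *: _); ring.
rewrite -scalemxAl mxtraceZ invfM invrK !scalerA; congr (_ *: _); ring.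
Qed.

Lemma fixed_point_rigid_or_gap A B : (0 < K)%N ->
  (forall i, x i != 0) -> spd T -> 0 < alpha0 -> spd A -> spd B ->
  fixed_point_eq x T alpha0 A -> fixed_point_eq x T alpha0 B ->
  psd (B - A) -> A = B \/ exists2 d, 0 < d & psd (B - A - d *: T).
Proof.
move=> K0 x0 spdT a0 spdA spdB eqA eqB leAB.
have leiAB := psd_invmxB spdA spdB leAB.
have [tr_ge0 tr_eq0] := psd_tr_spd leiAB spdT.
rewrite mulmxBl linearB /= in tr_ge0 tr_eq0.
have trA := spd_invmx_tr_gt0 K0 spdA spdT.
have trB := spd_invmx_tr_gt0 K0 spdB spdT.
move: tr_ge0; rewrite le_eqVlt => /orP[/eqP/esym/tr_eq0/subr0_eq iAB|].
  by left; rewrite -[A]invmxK iAB invmxK.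
rewrite subr_gt0 -ltf_pV2 // => tr_lt; right.
set tA := (\tr _)^-1 in tr_lt; set tB := (\tr _)^-1 in tr_lt.
(* This is exactly the difference of the two coefficients of [T], so subtracting it leaves only the
   [x i] terms. *)
exists (alpha0 / (1 + alpha0) * K%:R * (tB - tA)).
  by rewrite !mulr_gt0 ?invr_gt0 ?subr_gt0 ?ltr0n // addr_gt0.
rewrite {1}eqA {1}eqB -/tA -/tB.
rewrite opprD addrACA -!scalerBr -sumrB -!scalerBl !scalerA.
rewrite -addrA -scalerBl.
set d := (X in X *: T); have -> : d = 0 by rewrite /d; ring.
rewrite scale0r addr0; apply: psdZ.
  by rewrite !mulr_ge0 ?invr_ge0 // addr_ge0 // ltW.
elim/big_ind: _ => [||i _]; [exact: psd0 | exact: psdD |].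
rewrite -scalerBl; apply: psdZ; last exact: psd_rank1.
have [_ /(_ _ (x0 i)) iA] := (spdP (invmx A)).1 (spd_invmx spdA).
have [_ /(_ _ (x0 i)) iB] := (spdP (invmx B)).1 (spd_invmx spdB).
rewrite subr_ge0 lef_pV2 // -subr_ge0.
by have := leiAB.2 (x i); rewrite bilinDm bilinNm.
Qed.

End FixedPoint.

End Forms.

Theorem theorem6 (R : realType) (K N : nat) (K_gt0 : (0 < K)%N) (N_gt0 : (0 < N)%N)
    (x : 'I_N -> 'cV[R]_K) (x_neq0 : forall i, x i != 0)
    (T : 'M[R]_K) (T_spd : spd T)
    (alpha0 : R) (alpha0_gt0 : 0 < alpha0)
    (S1 S2 : 'M[R]_K) (S1_spd : spd S1) (S2_spd : spd S2)
    (S1_eq : fixed_point_eq x T alpha0 S1) (S2_eq : fixed_point_eq x T alpha0 S2) :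
  exists2 c : R, 0 < c & S1 = c *: S2.
Proof.
have [l [l0 le12 l_opt]] := spd_least_multiple K_gt0 S1_spd S2_spd.
exists l => //.
have [//|[d d0 gap]] := fixed_point_rigid_or_gap K_gt0 x_neq0 T_spd alpha0_gt0
  S1_spd (spdZ l0 S2_spd) S1_eq (fixed_point_eqZ l0 S2_spd S2_eq) le12.
have tr0 := spd_invmx_tr_gt0 K_gt0 T_spd S2_spd.
(* By [psd_trB], [S2] is at most its trace against [invmx T] times [T], so [d *: T] dominates this
   multiple of [S2]. *)
case: (l_opt (d / \tr (invmx T *m S2)) (divr_gt0 d0 tr0)).
have -> : l *: S2 - S1 - (d / \tr (invmx T *m S2)) *: S2 =
    (l *: S2 - S1 - d *: T) +
    (d / \tr (invmx T *m S2)) *: (\tr (invmx T *m S2) *: T - S2).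
  by rewrite scalerBr scalerA divfK ?gt_eqF // addrA subrK.
apply: psdD gap (psdZ _ (psd_trB S2_spd T_spd)).
by rewrite divr_ge0 // ltW.
Qed.
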